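(* The following equalities hold: $p_{lin}^2(4) = 6$, $p_{lin}^2(5) = 9$, $p_{lin}^3(5) = 6$, $p_{lin}^2(6) = 16$, $p_{lin}^3(6) = 12$, and $p_{lin}^4(6) = 9$. (Here superscripts are indices, not exponents.)
   Context: For an integer $n\ge 1$, the $n$-dimensional hypercube $Q_n$ is the graph with vertex set $\{0,1\}^n$ and edges between vertices that differ in exactly one coordinate. For $1 \le d \le n$, a $d$-dimensional subcube of $Q_n$ (a ''$Q_d$ in $Q_n$'') is represented by a string of length $n$ over $\{0,1,*\}$ with exactly $d$ stars; its vertices are the $2^d$ binary strings obtained by replacing each star by 0 or 1. A $Q_\ell$ is contained in a $Q_d$ if its vertex set is contained in that of the $Q_d$ (equivalently, its string is obtained from that of the $Q_d$ by replacing $d-\ell$ of the stars by 0's or 1's). Counting vector: for a $Q_\ell$ in $Q_n$, its counting vector is $(v_0,\ldots,v_\ell)\in \mathbb{Z}_{\ge 0}^{\ell+1}$, where $v_0$ is the number of 1's to the left of the first star, $v_\ell$ is the number of 1's to the right of the $\ell$th (last) star, and for $1\le i\le \ell-1$, $v_i$ is the number of 1's between the $i$th and $(i+1)$st stars. A $Q_\ell$-coloring of $Q_n$ is an assignment of a color from a set of colors to each $Q_\ell$ in $Q_n$. For integers $n \ge d \ge \ell \ge 1$, a $Q_\ell$-coloring of $Q_n$ is $d$-polychromatic if every $Q_d$ in $Q_n$ contains a $Q_\ell$ of every color in the set of colors. A $Q_\ell$-coloring is linear if the set of colors is a finite abelian group $Z$ and there is an additive map $\chi:\mathbb{Z}_{\ge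 0}^{\ell+1}\to Z$ (i.e. $\chi(v_0,\ldots,v_\ell)=\sum_{i=0}^{\ell} v_i h_i$ for some fixed $h_0,\ldots,h_\ell\in Z$) such that each $Q_\ell$ receives the color $\chi(v)$, where $v$ is its counting vector. The number of colors of such a coloring is $|Z|$. For $1\le \ell\le d$, $p_{lin}^{\ell}(d)$ denotes the maximum number of colors $M$ such that for all $n\ge d$, $Q_n$ has a $d$-polychromatic linear $Q_\ell$-coloring with $M$ colors. *)

(* Defs.v *)
From mathcomp Require Import all_boot all_order all_algebra.

Set Implicit Arguments.
Unset Strict Implicit.
Unset Printing Implicit Defensive.

(* A string over {0,1,*}: [Some false] is 0, [Some true] is 1, [None] is a star. *)
Notation star := (@None bool) (only parsing).

Definition subcube (n d : nat) : Type :=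
  {s : n.-tuple (option bool) | count_mem star s == d}.

Definition vertices (n d : nat) (c : subcube n d) : {set n.-tuple bool} :=
  [set x : n.-tuple bool |
    [forall i, (tnth (val c) i == star) || (tnth (val c) i == Some (tnth x i))]].

Definition contained (n l d : nat) (c : subcube n l) (D : subcube n d) : bool :=
  vertices c \subset vertices D.

(* Entry i counts the 1's having exactly i stars to their left: for 0 < i < l, the
   1's between the i-th and (i+1)-st stars. *)
Definition counting_vector (n l : nat) (c : subcube n l) : {ffun 'I_l.+1 -> nat} :=
  [ffun i : 'I_l.+1 =>
    #|[set j : 'I_n | (tnth (val c) j == Some true)
                      && (count_mem star (take j (val c)) == i)]|].

Definition polychromatic (n l d : nat) (C : Type) (f : subcube n l -> C) : Prop :=
  forall (D : subcube n d) (k : C),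
    exists2 c : subcube n l, contained c D & f c = k.

Definition linear_coloring (n l : nat) (Z : finZmodType)
    (f : subcube n l -> Z) : Prop :=
  exists h : 'I_l.+1 -> Z,
    forall c : subcube n l,
      f c = (\sum_(i < l.+1) h i *+ counting_vector c i)%R.

(* The group, and not only the map, may depend on n; only its order is fixed. *)
Definition lin_colorable (l d M : nat) : Prop :=
  forall n : nat, d <= n ->
    exists (Z : finZmodType) (f : subcube n l -> Z),
      [/\ #|Z| = M, linear_coloring f & polychromatic d f].

(* [is_plin l d M]: the maximum defining p_lin^l(d) exists and equals M. *)
Definition is_plin (l d M : nat) : Prop :=
  lin_colorable l d M /\ forall M' : nat, lin_colorable l d M' -> M' <= M.

(* Main.v *)
Require Import Defs.
From mathcomp Require Import all_boot all_order all_algebra.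
From HB Require Import structures.
From mathcomp Require Import fingroup cyclic zify.

Set Implicit Arguments.
Unset Strict Implicit.
Unset Printing Implicit Defensive.

Import GRing.Theory.
Local Open Scope ring_scope.

(** In a linear colouring the colour of a cube is the sum, over the 1's of its string, of
    h_i, where i is the number of stars to the left of that 1.  So the colours seen inside
    a Q_d depend only on the numbers a_0, ..., a_d of 1's in the gaps between its stars:
    keep l of the d stars, turn each of the others into 0 or 1, and add up.  The value
    a_0 only translates the set of colours, and since n is unbounded the a_i are arbitrary.
    Hence M colours are possible if and only if some abelian group of order M has elements
    h_0, ..., h_l for which the set of reachable sums is the whole group for every choice
    of the gaps; gaps matter only modulo the exponent of the group.  The predicate
    [gap_reach] is this set of sums, and [polychromatic_gap_reach] and
    [gap_reach_polychromatic] are the two halves of the translation.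

    With all gaps equal to 0 the reachable sums are the t_0 h_0 + ... + t_l h_l with
    t_0 + ... + t_l <= d - l ([gap_reach0]).  Two things follow from their being the whole
    group: the h_i generate it, and its order is at most a binomial coefficient
    ([card_le_binomial]).  So for the upper bounds only finitely many pairs (group,
    generators) matter, and they are examined one by one.  A pair is described by its
    relations in Hermite form: m_i is the order of h_i modulo the subgroup generated by the
    generators that precede it, and m_i h_i is a given element of that subgroup.  Every
    element is then a unique word in digits below the m_i, noncyclic groups need no special
    treatment, and no classification of abelian groups is used ([tower_step]).

    The relations are chosen one generator at a time.  The sums that use only
    h_0, ..., h_j form a column of sets which is obtained from the column for
    h_0, ..., h_(j-1) by a recurrence ([entryS]), so these sets are shared by all the
    continuations.  A branch is cut when the sums of the first generators already
    coincide too often for the sums with all gaps 0 to reach M elements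
    ([iter_partial_sums]).  At a leaf, a short list of gap sequences is tried, each with
    all values of the last gap but one; one of them misses a colour.  [refutesF] says that
    this search cannot succeed when a polychromatic colouring exists, and [upper_bound]
    turns its success into an inequality.  The search is run by computation in the kernel.

    For the lower bounds the same column sets, computed in a product of two cyclic groups
    for all gap sequences modulo the exponent, show that a given choice of the h_i works
    ([product_coloring]). *)

(** * Colours as weights of strings *)

Section Strings.

Variables (Z : zmodType) (h : nat -> Z).

(** [j] is the number of stars already read. *)
Fixpoint color_from (j : nat) (s : seq (option bool)) : Z :=
  match s with
  | [::] => 0
  | None :: s' => color_from j.+1 s'
  | Some b :: s' => h j *+ b + color_from j s'
  end.

Lemma color_from_rcons j s y :
  color_from j (rcons s y) =
  color_from j s + (if y is Some b then h (j + count_mem star s) *+ b else 0).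
Proof.
elim: s j => [|x s IH] j /=; first by case: y => [b|]; rewrite ?addn0 ?addr0 ?add0r.
by case: x => [b|]; rewrite IH ?addrA ?add0n ?addnA ?addn1.
Qed.

Lemma color_fromE j s :
  color_from j s =
  \sum_(k < size s) h (j + count_mem star (take k s)) *+ (nth star s k == Some true).
Proof.
elim: s j => [|x s IH] j /=; first by rewrite big_ord0.
rewrite big_ord_recl /=; case: x => [b|] /=; rewrite IH; last first.
  by rewrite mulr0n add0r; apply: eq_bigr => k _; rewrite addSnnS.
by rewrite addn0; congr (_ *+ _ + _); case: b.
Qed.

(** For strings of equal length this is containment of the subcubes ([containedP]). *)
Definition refines (c s : seq (option bool)) : bool :=
  all2 (fun x y => (y == star) || (x == y)) c s.

Lemma refines_rcons c s x y : size c = size s ->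
  refines (rcons c x) (rcons s y) = refines c s && ((y == star) || (x == y)).
Proof.
rewrite /refines; elim: c s => [|z c IH] [|w s] //=; first by rewrite andbT.
by case=> sz; rewrite IH // andbA.
Qed.

(** The argument is the reversed string, because the generator attached to a position is
    indexed by the number of stars kept before it: when the last character is removed, that
    number is known from [j], the number of stars that are kept in all. *)
Fixpoint reach (rs : seq (option bool)) (j : nat) (x : Z) : bool :=
  match rs with
  | [::] => (j == 0%N) && (x == 0)
  | Some b :: rs' => reach rs' j (x - h j *+ b)
  | None :: rs' =>
    [|| reach rs' j x, reach rs' j (x - h j) | if j is j'.+1 then reach rs' j' x else false]
  end.

Lemma reachP s j x :
  reflect (exists c, [/\ size c = size s, refines c s,
                      count_mem star c = j & color_from 0 c = x])
          (reach (rev s) j x).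
Proof.
elim/last_ind: s j x => [|s y IH] j x.
  rewrite /rev /=; apply: (iffP andP) => [[/eqP-> /eqP->]|[c []]]; first by exists [::].
  by move/size0nil-> => _ <- <-.
have snoc c z j' x' : size c = size s -> refines c s -> count_mem star c = j' ->
    color_from 0 c = x' -> (y == star) || (z == y) ->
    exists d, [/\ size d = size (rcons s y), refines d (rcons s y),
      count_mem star d = (j' + (z == star))%N
      & color_from 0 d = x' + (if z is Some b then h j' *+ b else 0)].
  move=> sc rc nc wc yz; exists (rcons c z); rewrite !size_rcons sc; split => //.
  - by rewrite refines_rcons // rc.
  - by rewrite -cats1 count_cat /= addn0 nc.
  - by rewrite color_from_rcons wc add0n nc.
have unsnoc d : size d = size (rcons s y) -> refines d (rcons s y) ->
    exists c z, [/\ d = rcons c z, size c = size s, refines c s & (y == star) || (z == y)].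
  case/lastP: d => [|c z]; rewrite !size_rcons // => -[sc].
  rewrite refines_rcons // => /andP[rc yz].
  by exists c, z.
rewrite rev_rcons /=; case: y snoc unsnoc => [b|] snoc unsnoc.
  apply: (iffP (IH _ _)) => [[c [sc rc nc wc]]|[d [sd rd nd wd]]].
    have [d [d1 d2 d3 d4]] := snoc c (Some b) _ _ sc rc nc wc (eqxx _).
    by exists d; rewrite d1 d2 d3 d4 addn0 subrK.
  have [c [z [ed sc rc /eqP ez]]] := unsnoc d sd rd; exists c; split => //.
    by rewrite -nd ed ez -cats1 count_cat /= !addn0.
  rewrite -wd ed ez color_from_rcons add0n -nd ed ez -cats1 count_cat /= !addn0.
  by rewrite addrK.
have [step|nostep] := boolP [|| _, _ | _]; constructor.
  case/or3P: step => [/IH[c [sc rc nc wc]]|/IH[c [sc rc nc wc]]|].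
  - have [d [d1 d2 d3 d4]] := snoc c (Some false) _ _ sc rc nc wc isT.
    by exists d; rewrite d1 d2 d3 d4 addn0 addr0.
  - have [d [d1 d2 d3 d4]] := snoc c (Some true) _ _ sc rc nc wc isT.
    by exists d; rewrite d1 d2 d3 d4 addn0 subrK.
  - case: j => [//|j] /IH[c [sc rc nc wc]].
    have [d [d1 d2 d3 d4]] := snoc c None _ _ sc rc nc wc isT.
    by exists d; rewrite d1 d2 d3 d4 addn1 addr0.
case=> d [sd rd nd wd]; case/negP: nostep.
have [c [z [ed sc rc _]]] := unsnoc d sd rd.
rewrite -nd -wd ed -cats1 count_cat cats1 color_from_rcons add0n /= addn0.
apply/or3P; case: z {ed} => [[]|] /=.
- by constructor 2; apply/IH; exists c; rewrite addn0 addrK.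
- by constructor 1; apply/IH; exists c; rewrite addn0 addr0.
- by constructor 3; rewrite addn1; apply/IH; exists c; rewrite addr0.
Qed.

End Strings.

(** If the string of [c] differs from that of [D] at a non-star of [D], then [c] has a vertex
    with the wrong value there. *)
Lemma containedP n l d (c : subcube n l) (D : subcube n d) :
  contained c D = refines (val c) (val D).
Proof.
have -> : refines (val c) (val D) =
    [forall i, (tnth (val D) i == star) || (tnth (val c) i == tnth (val D) i)].
  rewrite /refines all2E !size_tuple eqxx /=.
  apply/(all_nthP (star, star))/forallP => [H i|H i].
    have := H i; rewrite size_zip !size_tuple minnn ltn_ord => /(_ isT).
    by rewrite nth_zip ?size_tuple //= !(tnth_nth star).
  rewrite size_zip !size_tuple minnn => lin.
  by rewrite nth_zip ?size_tuple //=; have := H (Ordinal lin); rewrite !(tnth_nth star).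
apply/subsetP/forallP => [sub i|ref x].
  (* x is a vertex of c, and it differs from D at i whenever c allows that. *)
  pose x := [tuple if tnth (val c) k is Some b then b
                   else ~~ odflt false (tnth (val D) i) | k < n].
  have /sub : x \in vertices c.
    rewrite inE; apply/forallP => k; rewrite tnth_mktuple.
    by case: (tnth (val c) k) => //= b; rewrite eqxx.
  rewrite inE => /forallP/(_ i); rewrite tnth_mktuple.
  by case: (tnth (val D) i) => [[]|]; case: (tnth (val c) i) => [[]|].
rewrite !inE => /forallP xc; apply/forallP => i.
move: (ref i) (xc i); case: (tnth (val D) i) => [[]|] //;
  by case: (tnth (val c) i) => [[]|]; case: (tnth x i).
Qed.

Lemma counting_vectorE (Z : zmodType) n l (c : subcube n l) (h : 'I_l.+1 -> Z) :
  \sum_(i < l.+1) h i *+ counting_vector c i =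
  color_from (fun j => h (inord j)) 0 (val c).
Proof.
have leql k : (count_mem star (take k (val c)) < l.+1)%N.
  rewrite ltnS -[leqRHS](eqP (valP c)) -[in leqRHS](cat_take_drop k (val c)).
  by rewrite count_cat leq_addr.
rewrite color_fromE.
under eq_bigr => i _ do rewrite ffunE -sumr_const.
under eq_bigr => i _ do under eq_bigl => j do rewrite inE.
rewrite (exchange_big_dep (fun j : 'I_n => tnth (val c) j == Some true)) /=; last first.
  by move=> i j _ /andP[].
rewrite size_tuple big_mkcond; apply: eq_bigr => j _; rewrite -tnth_nth add0n.
case: eqP => // _; rewrite (big_pred1 (inord (count_mem star (take j (val c))))) //.
by move=> i; rewrite /= -val_eqE /= inordK // eq_sym.
Qed.

(** * Gap sequences *)

Section Gaps.

Variables (Z : zmodType) (h : nat -> Z).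

(** [gs] lists, from right to left, the number of 1's that follow each star; the gap before
    the first star is left out, since it only translates the set of sums. *)
Fixpoint gap_reach (gs : seq nat) (j : nat) (x : Z) : bool :=
  if gs is a :: gs' then
    let y := x - h j *+ a in
    [|| gap_reach gs' j y, gap_reach gs' j (y - h j)
      | if j is j'.+1 then gap_reach gs' j' y else false]
  else (j == 0%N) && (x == 0).

Lemma gap_reach_cons a gs j x :
  gap_reach (a :: gs) j x =
  [|| gap_reach gs j (x - h j *+ a), gap_reach gs j (x - h j *+ a - h j)
    | if j is j'.+1 then gap_reach gs j' (x - h j *+ a) else false].
Proof. by []. Qed.

Lemma reach_ones a rs j x :
  reach h (nseq a (Some true) ++ rs) j x = reach h rs j (x - h j *+ a).
Proof.
elim: a x => [|a IH] x /=; first by rewrite subr0.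
by rewrite IH [in RHS]mulrS opprD addrA.
Qed.

Lemma reach_zeros a rs j x : reach h (nseq a (Some false) ++ rs) j x = reach h rs j x.
Proof. by elim: a => //= a IH; rewrite mulr0n subr0 IH. Qed.

Definition gap_string (gs : seq nat) : seq (option bool) :=
  flatten [seq rcons (nseq a (Some true)) star | a <- gs].

Lemma size_gap_string gs : size (gap_string gs) = (sumn gs + size gs)%N.
Proof.
by elim: gs => //= a gs IH; rewrite size_cat size_rcons size_nseq IH addSnnS addnS addnA addnS.
Qed.

Lemma stars_gap_string gs : count_mem star (gap_string gs) = size gs.
Proof.
elim: gs => //= a gs IH; rewrite count_cat IH -cats1 count_cat.
by rewrite count_nseq.
Qed.

Lemma reach_gap_string gs j x : reach h (gap_string gs) j x = gap_reach gs j x.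
Proof.
elim: gs j x => //= a gs IH j x.
rewrite /gap_string /= -/(gap_string gs) cat_rcons reach_ones /= !IH; congr [|| _, _ | _].
by case: j => // j; rewrite IH.
Qed.

(** Zeros do not count, and the 1's before the first star all contribute [h 0], so every
    string is a translate of a gap sequence. *)
Lemma reach_gaps rs : exists a gs, size gs = count_mem star rs /\
  forall j x, reach h rs j (x + h 0%N *+ a) = gap_reach gs j x.
Proof.
elim: rs => [|y rs [a [gs [sz E]]]] /=.
  by exists 0%N, [::]; split=> // j x; rewrite addr0.
case: y => [[]|] /=.
- case: gs sz E => [|b gs] sz E.
    exists a.+1, [::]; split=> // j x; rewrite mulr1n mulrS.
    have -> : x + (h 0%N + h 0%N *+ a) - h j = x + (h 0%N - h j) + h 0%N *+ a.
      by rewrite -!addrA; congr (_ + (_ + _)); rewrite addrC.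
    by rewrite E /=; case: j => // ; rewrite subrr addr0.
  exists a, (b.+1 :: gs); split=> // j x.
  by rewrite mulr1n addrAC E /= mulrS opprD addrA.
- by exists a, gs; split=> // j x; rewrite mulr0n subr0 E.
- exists a, (0%N :: gs); split=> [|j x]; first by rewrite /= sz.
  rewrite /= subr0 E addrAC E; congr [|| _, _ | _].
  by case: j => // j; rewrite E.
Qed.

Lemma gap_reach_mod e gs j x : (forall z : Z, z *+ e = 0) ->
  gap_reach [seq (a %% e)%N | a <- gs] j x = gap_reach gs j x.
Proof.
move=> he; elim: gs j x => //= a gs IH j x.
have -> : h j *+ (a %% e) = h j *+ a.
  by rewrite {2}(divn_eq a e) mulrnDr mulrnA he add0r.
by rewrite !IH; case: j => // j; rewrite IH.
Qed.

Lemma gap_reach_short gs j x : (size gs < j)%N -> gap_reach gs j x = false.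
Proof.
elim: gs j x => [|a gs IH] [|j] x //= lt.
by rewrite !IH //; apply: ltn_trans lt.
Qed.

(** The sums t_0 h_0 + ... + t_(k-1) h_(k-1) with t_0 + ... + t_(k-1) at most [t]. *)
Fixpoint simplex (k t : nat) (x : Z) {struct k} : bool :=
  if k is k'.+1 then
    (fix add_gen t x := simplex k' t x || (if t is t'.+1 then add_gen t' (x - h k') else false)) t x
  else x == 0.

Lemma simplexS k t x :
  simplex k.+1 t x = simplex k t x || (if t is t'.+1 then simplex k.+1 t' (x - h k) else false).
Proof. by case: t. Qed.

Lemma simplex_mono k t x : simplex k t x -> simplex k t.+1 x.
Proof.
elim: k t x => // k IHk; elim=> [|t IHt] x; rewrite [simplex _ _ _]simplexS.
  by rewrite orbF => /IHk; rewrite simplexS => ->.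
case/orP=> [/IHk H|/IHt H]; first by rewrite simplexS H.
by rewrite [simplex _ _ _]simplexS H orbT.
Qed.

Lemma simplex0 k t : simplex k t 0.
Proof. by elim: k => [|k IH]; [rewrite /= eqxx | rewrite simplexS IH]. Qed.

(** With empty gaps, a discarded star contributes h_i or nothing, where i is the number of
    kept stars before it, and any multiset of [t] indices occurs. *)
Lemma gap_reach0 j t x : gap_reach (nseq (j + t) 0) j x = simplex j.+1 t x.
Proof.
elim: j t x => [|j IHj]; elim=> [|t IHt] x.
- by rewrite /= orbF.
- rewrite addnS [LHS]/= subr0 !IHt [RHS]simplexS.
  case: (boolP (simplex 1 t x)) => [/simplex_mono|x0]; first by rewrite simplexS => ->.
  by rewrite orbF /=; case: eqP x0 => // ->; rewrite simplex0.
- rewrite addn0 [LHS]/= subr0 !(gap_reach_short (j := j.+1)) ?size_nseq //.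
  by have := IHj 0%N x; rewrite addn0 => ->; rewrite [RHS]simplexS orbF.
rewrite addnS -[nseq _ _]/(0%N :: nseq (j.+1 + t) 0) gap_reach_cons subr0 !IHt.
rewrite addSnnS IHj [RHS]simplexS.
case: (boolP (simplex j.+2 t x)) => [/simplex_mono|_]; last by rewrite /= orbC.
by rewrite simplexS => ->.
Qed.

End Gaps.

(** * Polychromatic colourings *)

Section Polychromatic.

Variables (n l d : nat) (Z : finZmodType) (h : 'I_l.+1 -> Z).
Let hn (j : nat) : Z := h (inord j).
Variable f : subcube n l -> Z.
Hypothesis fE : forall c, f c = \sum_(i < l.+1) h i *+ counting_vector c i.

Lemma polychromatic_gap_reach (gs : seq nat) x :
  polychromatic d f -> size gs = d -> (sumn gs + d <= n)%N -> gap_reach hn gs l x.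
Proof.
move=> poly sz le; pose rs := nseq (n - (sumn gs + d)) (Some false) ++ gap_string gs.
have sizeD : size (rev rs) == n.
  by rewrite size_rev size_cat size_nseq size_gap_string sz subnK.
have countD : count_mem star (Tuple sizeD) == d.
  by rewrite /= count_rev count_cat count_nseq stars_gap_string sz.
have [c cD <-] := poly (Sub (Tuple sizeD) countD) x.
rewrite fE counting_vectorE -reach_gap_string -(reach_zeros _ (n - (sumn gs + d))).
rewrite -[nseq _ _ ++ _]revK; apply/reachP; exists (val c); split=> //.
- by rewrite size_tuple (eqP sizeD).
- by move: cD; rewrite containedP.
- exact/eqP/(valP c).
Qed.

Lemma gap_reach_polychromatic :
  (forall gs x, size gs = d -> gap_reach hn gs l x) -> polychromatic d f.
Proof.
move=> reachall D x; have [a [gs [sz E]]] := reach_gaps hn (rev (val D)).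
have := reachall gs (x - hn 0%N *+ a); rewrite sz count_rev (eqP (valP D)) => /(_ erefl).
rewrite -E subrK => /reachP[c [sc rc nc wc]].
have sizec : size c == n by rewrite sc size_tuple.
have countc : count_mem star (Tuple sizec) == l by rewrite /= nc.
exists (Sub (Tuple sizec) countc); first by rewrite containedP.
by rewrite fE counting_vectorE.
Qed.

End Polychromatic.

(** * Presentations of finite abelian groups *)

Local Open Scope nat_scope.

(** A tower lists pairs (m, c), the last generator first: m is the order of that generator
    modulo the subgroup generated by the others, and c is the word, in the rest of the
    tower, of its m-th multiple.  A word has one digit for each pair, below m. *)
Definition digits := seq nat.
Definition tower := seq (nat * digits).

Fixpoint all_digits (t : tower) : seq digits :=
  if t is (m, _) :: t' then [seq q :: e | q <- iota 0 m, e <- all_digits t']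
  else [:: [::]].

(** Addition with carry: m times a generator is replaced by the word c. *)
Fixpoint addd (t : tower) (e f : digits) : digits :=
  match t, e, f with
  | (m, c) :: t', q :: e', p :: f' =>
    let g := addd t' e' f' in
    if m <= q + p then (q + p - m) :: addd t' c g else (q + p) :: g
  | _, _, _ => [::]
  end.

Fixpoint muld (t : tower) (a : nat) (e : digits) : digits :=
  if a is a'.+1 then (if a' is 0 then e else addd t e (muld t a' e)) else nseq (size t) 0.

(** A subset of the presented group, as nested lists of booleans indexed by the digits. *)
Fixpoint table (t : tower) : Type := if t is _ :: t' then seq (table t') else bool.

Fixpoint empty (t : tower) : table t :=
  if t is (m, _) :: t' then nseq m (empty t') else false.

(** A subset of the subgroup presented by [t], seen in the larger group: all cosets other
    than the first are empty. *)
Definition lift (t : tower) m c (s : table t) : table ((m, c) :: t) :=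
  s :: nseq m.-1 (empty t).

Fixpoint is_zero (e : digits) : bool :=
  if e is q :: e' then (if q is 0 then is_zero e' else false) else true.

(** Translation by an element is a rotation of the list of cosets; the cosets that go past
    the end are moreover translated by the word c, as in [addd]. *)
Fixpoint shift (t : tower) : digits -> table t -> table t :=
  match t with
  | [::] => fun _ s => s
  | (m, c) :: t' => fun e s =>
    let shift_all d u := if is_zero d then u else map (shift (t := t') d) u in
    let u := shift_all (behead e) s in
    if head 0 e is 0 then u
    else let k := m - head 0 e in shift_all c (drop k u) ++ take k u
  end.

Definition shift_by t a g (s : table t) := if a is 0 then s else shift (muld t a g) s.

(** Nested [if]s rather than [||], here and likewise in [all3] and [all_lazy], let a call by
    value evaluation stop at the first decisive argument. *)
Definition or3 (a b c : bool) : bool := if a then true else if b then true else c.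

Fixpoint map3 (A B : Type) (f : A -> A -> A -> B) (s u v : seq A) : seq B :=
  match s, u, v with
  | x :: s', y :: u', z :: v' => f x y z :: map3 f s' u' v'
  | _, _, _ => [::]
  end.

Fixpoint all3 (A : Type) (f : A -> A -> A -> bool) (s u v : seq A) : bool :=
  match s, u, v with
  | x :: s', y :: u', z :: v' => if f x y z then all3 f s' u' v' else false
  | _, _, _ => true
  end.

Fixpoint union3 (t : tower) : table t -> table t -> table t -> table t :=
  if t is _ :: t' then map3 (@union3 t') else or3.

Fixpoint cover3 (t : tower) : table t -> table t -> table t -> bool :=
  if t is _ :: t' then all3 (@cover3 t') else or3.

Fixpoint weight (t : tower) : table t -> nat :=
  if t is _ :: t' then fun s => sumn (map (@weight t') s) else nat_of_bool.

(** * What towers and tables mean in a group *)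

Section TowerSemantics.

Variable Z : zmodType.
Implicit Types (t : tower) (bs : seq Z) (e f : digits) (P Q R : pred Z).
Local Open Scope ring_scope.

Fixpoint value bs e : Z :=
  match bs, e with b :: bs', q :: e' => b *+ q + value bs' e' | _, _ => 0 end.

Definition span t bs : seq Z := [seq value bs e | e <- all_digits t].

(** The last clause, that no smaller multiple of the generator lies in the subgroup, makes
    words unique ([value_inj]); this is what lets a table be computed for a given subset. *)
Fixpoint presents t bs : Prop :=
  match t, bs with
  | [::], [::] => True
  | (m, c) :: t', b :: bs' =>
    [/\ presents t' bs', (0 < m)%N, c \in all_digits t', b *+ m = value bs' c
      & forall q, (0 < q < m)%N -> b *+ q \notin span t' bs']
  | _, _ => False
  end.

(** The table [s] is the characteristic function of [P] on words.  It is stated coset by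
    coset so that it follows the recursion of the operations on tables. *)
Fixpoint represents t bs : table t -> pred Z -> Prop :=
  match t with
  | [::] => fun s P => s = P 0
  | (m, _) :: t' => fun s P =>
    size s = m /\
    forall q, (q < m)%N ->
      represents (behead bs) (nth (empty t') s q) (fun x => P (head 0 bs *+ q + x))
  end.

Lemma mem_all_digits m c t q e :
  (q :: e \in all_digits ((m, c) :: t)) = (q < m)%N && (e \in all_digits t).
Proof.
apply/allpairsP/andP => [[[p f] /= [pm ft [-> ->]]]|[qm et]].
  by move: pm; rewrite mem_iota.
by exists (q, e); rewrite mem_iota.
Qed.

Lemma digits_consP m c t e :
  e \in all_digits ((m, c) :: t) ->
  exists q f, [/\ e = q :: f, (q < m)%N & f \in all_digits t].
Proof.
by case/allpairsP=> [[q f] /= [qm ft ->]]; exists q, f; move: qm; rewrite mem_iota.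
Qed.

Lemma value_nseq0 bs k : value bs (nseq k 0%N) = 0.
Proof. by elim: bs k => [|b bs IH] [|k] //=; rewrite IH addr0. Qed.

Lemma nseq0_digits t bs : presents t bs -> nseq (size t) 0%N \in all_digits t.
Proof.
elim: t bs => [|[m c] t IH] [|b bs] //= [/IH H m_gt0 _ _ _].
by rewrite [_ \in _](mem_all_digits m c) m_gt0.
Qed.

Lemma adddP t bs e f : presents t bs -> e \in all_digits t -> f \in all_digits t ->
  addd t e f \in all_digits t /\ value bs (addd t e f) = value bs e + value bs f.
Proof.
elim: t bs e f => [|[m c] t IH] [|b bs] e f //=.
  by move=> _ _ _; rewrite addr0.
move=> [pt m_gt0 ct bm _].
move=> /(digits_consP (c := c))[q [e' [-> qm et]]] /(digits_consP (c := c))[p [f' [-> pm ft]]] /=.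
have [gt vg] := IH bs e' f' pt et ft.
case: leqP => [le|lt]; last first.
  by rewrite [_ \in _](mem_all_digits m c) lt gt /= vg mulrnDr addrACA.
have [ht vh] := IH bs c _ pt ct gt; rewrite [_ \in _](mem_all_digits m c) ht /= vh vg.
split; first by rewrite andbT; lia.
by rewrite addrA -bm -mulrnDr subnK // mulrnDr addrACA.
Qed.

Lemma muldP t bs a e : presents t bs -> e \in all_digits t ->
  muld t a e \in all_digits t /\ value bs (muld t a e) = value bs e *+ a.
Proof.
move=> pt et; elim: a => [|[|a] IH] /=.
- by rewrite (nseq0_digits pt) value_nseq0.
- by rewrite et.
- by have [H1 H2] := IH; have [H3 ->] := adddP pt et H1; rewrite H3 H2 -mulrS.
Qed.

Lemma spanP t bs x : reflect (exists2 e, e \in all_digits t & x = value bs e) (x \in span t bs).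
Proof. exact: mapP. Qed.

Lemma spanD t bs x y : presents t bs -> x \in span t bs -> y \in span t bs ->
  x + y \in span t bs.
Proof.
move=> pt /spanP[e et ->] /spanP[f ft ->].
by have [H <-] := adddP pt et ft; apply/spanP; exists (addd t e f).
Qed.

Lemma span_cons m c t b bs x :
  reflect (exists q y, [/\ (q < m)%N, y \in span t bs & x = b *+ q + y])
          (x \in span ((m, c) :: t) (b :: bs)).
Proof.
apply: (iffP (spanP _ _ _)) => [[e /digits_consP[q [f [-> qm ft]]] ->]
                               |[q [y [qm /spanP[f ft ->] ->]]]].
  by exists q, (value bs f); split=> //; apply/spanP; exists f.
by exists (q :: f); rewrite // mem_all_digits qm.
Qed.

Lemma represents_ext t bs (s : table t) P Q : P =1 Q -> represents bs s P -> represents bs s Q.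
Proof.
elim: t bs s P Q => [|[m c] t IH] bs s P Q PQ /=; first by rewrite PQ.
by case=> sz H; split=> // q /H; apply: IH => x; rewrite PQ.
Qed.

Lemma represents_empty t bs P : (forall x, x \in span t bs -> ~~ P x) -> presents t bs ->
  represents bs (empty t) P.
Proof.
elim: t bs P => [|[m c] t IH] [|b bs] P //= nP.
  by move=> _; apply/esym/negbTE/nP; rewrite inE.
move=> [pt _ _ _ _]; rewrite size_nseq; split=> // q qm; rewrite nth_nseq qm.
by apply: IH => // x xs; apply: nP; apply/span_cons; exists q, x.
Qed.

Lemma is_zeroP e : is_zero e -> e = nseq (size e) 0%N.
Proof. by elim: e => //= -[|//] e IH /IH {1}->. Qed.

Lemma represents_shift t bs e (s : table t) P : presents t bs -> e \in all_digits t ->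
  represents bs s P -> represents bs (shift e s) (fun x => P (x - value bs e)).
Proof.
elim: t bs e s P => [|[m c] t IH] [|b bs] e s P //=.
  by move=> _ _ ->; rewrite subr0.
move=> [pt m_gt0 ct bm _] /(digits_consP (c := c))[q [f [-> qm ft]]] [sz rep] /=.
pose sh d (u : seq (table t)) := if is_zero d then u else map (shift d) u.
have szsh d u : size (sh d u) = size u by rewrite /sh; case: ifP; rewrite ?size_map.
have shP d u i Q : d \in all_digits t -> (i < size u)%N ->
    represents bs (nth (empty t) u i) Q ->
    represents bs (nth (empty t) (sh d u) i) (fun x => Q (x - value bs d)).
  move=> dt iu ru; rewrite /sh; case: ifP => [/is_zeroP->|_].
    by apply: represents_ext ru => x; rewrite value_nseq0 subr0.
  by rewrite (nth_map (empty t)) //; apply: IH.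
rewrite -/(sh f s); case: q qm => [|q] qm; rewrite -?/(sh c _).
  rewrite szsh; split=> // i im.
  apply: represents_ext (shP f s i _ ft _ (rep i im)); last by rewrite sz.
  by move=> x /=; rewrite mulr0n add0r addrA.
set k := (m - q.+1)%N; have km : (k <= m)%N by rewrite leq_subr.
rewrite size_cat szsh size_drop size_take szsh sz; split; first by case: ltnP; lia.
move=> i im; rewrite nth_cat szsh size_drop szsh sz.
case: ltnP => ilt.
  have iu : (k + i < m)%N by lia.
  have := shP f s _ _ ft _ (rep _ iu); rewrite sz => /(_ iu).
  rewrite -nth_drop => /(shP c _ i _ ct); rewrite size_drop szsh sz => /(_ ilt).
  apply: represents_ext => x /=; congr (P _).
  have -> : (k + i)%N = (m + i - q.+1)%N by lia.
  rewrite mulrnBr; last by lia.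
  rewrite mulrnDr bm [LHS](AC (3*3) ((2*4)*(3*6)*(1*5)))/= subrr addr0 opprD.
  by rewrite !addrA.
have jm : (i - (m - k) < k)%N by lia.
have im' : (i - (m - k) < m)%N by lia.
rewrite nth_take //; have := shP f s _ _ ft _ (rep _ im'); rewrite sz => /(_ im').
apply: represents_ext => x /=; congr (P _).
have -> : (m - k)%N = q.+1 by lia.
rewrite mulrnBr; last by lia.
by rewrite opprD addrACA.
Qed.

Lemma represents_shift_by t bs a e (s : table t) P : presents t bs -> e \in all_digits t ->
  represents bs s P -> represents bs (shift_by a e s) (fun x => P (x - value bs e *+ a)).
Proof.
move=> pt et rs; rewrite /shift_by; case: a => [|a].
  by apply: represents_ext rs => x; rewrite subr0.
have [at_ va] := muldP a.+1 pt et.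
by apply: represents_ext (represents_shift pt at_ rs) => x; rewrite va.
Qed.

Lemma or3E a b c : or3 a b c = [|| a, b | c].
Proof. by case: a; case: b. Qed.

Lemma size_map3 (A B : Type) (f : A -> A -> A -> B) s u v :
  size s = size u -> size u = size v -> size (map3 f s u v) = size s.
Proof. by elim: s u v => [|x s IH] [|y u] [|z v] //= [su] [uv]; rewrite IH. Qed.

Lemma nth_map3 (A B : Type) (f : A -> A -> A -> B) x0 y0 s u v i :
  size s = size u -> size u = size v -> (i < size s)%N ->
  nth y0 (map3 f s u v) i = f (nth x0 s i) (nth x0 u i) (nth x0 v i).
Proof.
elim: s u v i => [|x s IH] [|y u] [|z v] //= [|i] //= [su] [uv]; rewrite ltnS; exact: IH.
Qed.

Lemma all3P (A : Type) (f : A -> A -> A -> bool) x0 s u v :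
  size s = size u -> size u = size v ->
  reflect (forall i, (i < size s)%N -> f (nth x0 s i) (nth x0 u i) (nth x0 v i)) (all3 f s u v).
Proof.
elim: s u v => [|x s IH] [|y u] [|z v] //=; first by move=> *; constructor.
move=> [su] [uv]; case: ifPn => fxyz; last first.
  by constructor=> /(_ 0%N isT) /=; apply/negP.
apply: (iffP (IH _ _ su uv)) => [H [|i] //|H i ilt]; first exact: H.
exact: (H i.+1).
Qed.

Lemma represents_union3 t bs (s u v : table t) P Q R :
  represents bs s P -> represents bs u Q -> represents bs v R ->
  represents bs (union3 s u v) (fun x => [|| P x, Q x | R x]).
Proof.
elim: t bs s u v P Q R => [|[m c] t IH] bs s u v P Q R /=.
  by move=> -> -> ->; rewrite or3E.
move=> [ss sP] [su uP] [sv vP].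
have [e1 e2] : size s = size u /\ size u = size v by rewrite ss su sv.
split=> [|q qm]; first by rewrite size_map3.
by rewrite (nth_map3 _ (empty t)) ?ss //; apply: IH; [apply: sP|apply: uP|apply: vP].
Qed.

Lemma cover3P t bs (s u v : table t) P Q R : presents t bs ->
  represents bs s P -> represents bs u Q -> represents bs v R ->
  reflect {in span t bs, forall x, [|| P x, Q x | R x]} (cover3 s u v).
Proof.
elim: t bs s u v P Q R => [|[m c] t IH] [|b bs] s u v P Q R //=.
  move=> _ -> -> ->; rewrite or3E; apply: (iffP idP) => [H x|->//].
    by rewrite inE => /eqP->.
  by rewrite inE.
move=> [pt _ _ _ _] [ss sP] [su uP] [sv vP].
have [e1 e2] : size s = size u /\ size u = size v by rewrite ss su sv.
apply: (iffP (all3P _ (empty t) e1 e2)); rewrite ss => H.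
  move=> x /span_cons[q [y [qm yt ->]]].
  exact: (elimT (IH _ _ _ _ _ _ _ pt (sP q qm) (uP q qm) (vP q qm)) (H q qm)).
move=> q qm; apply/(IH _ _ _ _ _ _ _ pt (sP q qm) (uP q qm) (vP q qm)) => y yt.
by apply: H; apply/span_cons; exists q, y.
Qed.

Lemma weightE t bs (s : table t) P : represents bs s P -> presents t bs ->
  weight s = count P (span t bs).
Proof.
elim: t bs s P => [|[m c] t IH] [|b bs] s P //=; first by move=> ->; rewrite addn0.
move=> [sz rep] [pt _ _ _ _].
rewrite /span [all_digits _]/= map_allpairs count_flatten -map_comp.
rewrite -[s in LHS](mkseq_nth (empty t)) sz /mkseq -map_comp; congr sumn.
apply/eq_in_map => q; rewrite mem_iota /= => qm.
rewrite (IH _ _ _ (rep q qm) pt) /span !count_map.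
exact: eq_count.
Qed.

End TowerSemantics.

(** * Every generated subgroup has a tower *)

Section TowerGroup.

Variable Z : finZmodType.
Implicit Types (t : tower) (bs : seq Z).
Local Open Scope ring_scope.

Lemma mulr_card (x : Z) : x *+ #|Z| = 0.
Proof. by rewrite -FinRing.zmodXgE -cardsT; apply: expg_cardG; rewrite inE. Qed.

Lemma span0 t bs : presents t bs -> 0 \in span t bs.
Proof.
move=> pt; apply/spanP; exists (nseq (size t) 0%N); first exact: nseq0_digits pt.
by rewrite value_nseq0.
Qed.

Lemma spanMn t bs x a : presents t bs -> x \in span t bs -> x *+ a \in span t bs.
Proof.
move=> pt /spanP[e et ->]; have [ae <-] := muldP a pt et.
by apply/spanP; exists (muld t a e).
Qed.

Lemma spanN t bs x : presents t bs -> x \in span t bs -> - x \in span t bs.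
Proof.
move=> pt xt; have -> : - x = x *+ #|Z|.-1; last exact: spanMn.
apply/eqP; rewrite eq_sym -addr_eq0 -mulrSr prednK ?mulr_card //.
by apply/card_gt0P; exists 0.
Qed.

Lemma spanBr t bs x y : presents t bs -> y \in span t bs ->
  (x - y \in span t bs) = (x \in span t bs).
Proof.
move=> pt yt; apply/idP/idP => xt; last exact: spanD (spanN pt yt).
by rewrite -(subrK y x); apply: spanD.
Qed.

Lemma value_inj t bs : presents t bs -> {in all_digits t &, injective (value bs)}.
Proof.
elim: t bs => [|[m c] t IH] [|b bs] //=; first by move=> _ e f; rewrite !inE => /eqP-> /eqP->.
move=> [pt m_gt0 ct bm nb] e f.
move=> /(digits_consP (c := c))[q [e' [-> qm et]]] /(digits_consP (c := c))[p [f' [-> pm ft]]] /= E.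
have key q1 e1 q2 e2 : (q1 <= q2)%N -> (q2 < m)%N -> e1 \in all_digits t -> e2 \in all_digits t ->
    b *+ q1 + value bs e1 = b *+ q2 + value bs e2 -> q1 = q2.
  move=> le lt e1t e2t E12; apply/eqP; rewrite eqn_leq le /= leqNgt; apply/negP => lt12.
  have /negP[] := nb (q2 - q1)%N ltac:(lia).
  have -> : b *+ (q2 - q1) = value bs e1 - value bs e2.
    rewrite mulrnBr //; apply/eqP; rewrite subr_eq addrAC.
    by rewrite [value bs e1 + _]addrC E12 addrK.
  by rewrite spanBr //; apply/spanP; [exists e1 | exists e2].
have qp : q = p.
  by case/orP: (leq_total q p) => /key H; [|apply/esym];
    apply: (H) E || apply: (H) (esym E).
by move: E; rewrite qp => /addrI E; congr (_ :: _); apply: IH pt _ _ _ _ E.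
Qed.

Lemma card_span t bs : presents t bs -> #|span t bs| = size (all_digits t).
Proof.
move=> pt; rewrite -(size_map (value bs)); apply/card_uniqP.
rewrite map_inj_in_uniq; last exact: value_inj.
elim: t {pt} => //= -[m c] t IH; apply: allpairs_uniq => //; first exact: iota_uniq.
by move=> [q e] [p f] _ _ /= [-> ->].
Qed.

(** Lagrange: words biject with a subgroup. *)
Lemma all_digits_dvd t bs : presents t bs -> (size (all_digits t) %| #|Z|)%N.
Proof.
move=> pt; have gp : group_set [set x : Z | x \in span t bs].
  apply/group_setP; split; first by rewrite inE span0.
  by move=> x y; rewrite !inE; apply: spanD.
have := cardSg (subsetT (Group gp)); rewrite cardsT cardsE (card_span pt).
exact.
Qed.

Lemma size_all_digits_cons m c t :
  size (all_digits ((m, c) :: t)) = (m * size (all_digits t))%N.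
Proof. by rewrite /= size_allpairs size_iota. Qed.

(** Here [m] is the order of [u] modulo the subgroup presented so far. *)
Lemma tower_step t bs (u : Z) : presents t bs ->
  exists m c, [/\ c \in all_digits t, u *+ m = value bs c & presents ((m, c) :: t) (u :: bs)].
Proof.
move=> pt; have ex : exists m, (0 < m)%N && (u *+ m \in span t bs).
  exists #|Z|; rewrite mulr_card span0 // andbT.
  by apply/card_gt0P; exists 0.
case: (ex_minnP ex) => m /andP[m_gt0 /spanP[c ct um]] min.
exists m, c; split=> //; split=> // q /andP[q_gt0 qm]; apply/negP => uq.
by have := min q; rewrite q_gt0 uq leqNgt qm => /(_ isT).
Qed.

Lemma represents_lift t bs m c u (s : table t) (P : pred Z) :
  presents ((m, c) :: t) (u :: bs) -> {subset P <= span t bs} ->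
  represents bs s P -> represents (u :: bs) (lift m c s) P.
Proof.
move=> /= [pt m_gt0 ct um nu] supp rs; split; first by rewrite /= size_nseq prednK.
move=> [|q] qm /=; first by apply: represents_ext rs => x; rewrite mulr0n add0r.
rewrite nth_nseq -(ltn_predK m_gt0) ltnS in qm *.
rewrite qm; apply: (represents_empty _ pt) => x xt; apply/negP => /supp Px.
have /negP[] := nu q.+1 ltac:(lia).
by rewrite -(addrK x (u *+ q.+1)) (spanBr _ pt xt).
Qed.

End TowerGroup.

(** * The search *)

(** The column of a generator h_k: its entry number i is the set of sums for the first
    k + i stars of a gap sequence when exactly k of them are kept.  The next star is kept or
    contributes 0 or the current generator, so the entry is the translate, by the gap, of
    the union of an entry of the previous column with the entry [prev] before it and with
    [prev] translated by the generator. *)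
Fixpoint next_entries t (g : digits) (prev : table t) (gaps : seq nat) (col : seq (table t)) :=
  match gaps, col with
  | a :: gaps', s :: col' =>
    let r := shift_by a g (union3 s prev (shift g prev)) in
    r :: next_entries g r gaps' col'
  | _, _ => [::]
  end.

(** The gaps that are still to be read, and the column reached so far. *)
Definition state t := (seq nat * seq (table t))%type.

Definition next_column t g (st : state t) : seq (table t) :=
  match st.1, st.2 with
  | a :: gaps, s :: col => let r := shift_by a g s in r :: next_entries g r gaps col
  | _, _ => [::]
  end.

(** A column for no generator at all, in the trivial group: its first entry is {0} and the
    others are empty, which makes the recurrence produce the column of h_0.  The gap 0 put
    in front stands for the omitted gap before the first star, and the one put at the end
    is the last gap but one, whose value is varied by [robust]. *)
Definition start D (p : seq nat) : state [::] := (0 :: rcons p 0, true :: nseq D false).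

Definition advance t g (st : state t) : state t := (behead st.1, next_column g st).

Definition extend t m c (st : state t) : state ((m, c) :: t) := (st.1, map (lift m c) st.2).

(** The tables [A] and [B] collect the sums for all stars but the last when l - 1,
    respectively l, of them are kept.  Then the last star is kept, respectively it
    contributes 0 or [g2].  Enlarging the gap before the last star by one translates [A] by
    [g1] and [B] by [g2]; the first [n] values of that gap are tried. *)
Fixpoint robust t n (g1 g2 : digits) (A B : table t) : bool :=
  if n is n'.+1 then
    let B' := shift g2 B in
    if cover3 A B B' then robust n' g1 g2 (shift g1 A) B' else false
  else true.

Definition survives n t (g1 g2 : digits) (st : state t) : bool :=
  robust n g1 g2 (last (empty t) st.2) (last (empty t) (next_column g2 st)).

Fixpoint all_lazy (T : Type) (f : T -> bool) s :=
  if s is x :: s' then (if f x then all_lazy f s' else false) else true.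

(** Bounds for the numbers of sums with at most 0, 1, 2, ... summands, after one more
    generator is allowed: an element with at most t summands either avoids the new
    generator or becomes one with at most t - 1 summands when it is removed. *)
Fixpoint partial_sums (x : nat) (ns : seq nat) : seq nat :=
  if ns is n :: ns' then (x + n) :: partial_sums (x + n) ns' else [::].

Section Search.

Variable M : nat.

(** A generator [g] has just been chosen, and [r] of them are still to come.  The state
    [st0], with all gaps 0, is kept apart because it also bounds the number of colours. *)
Definition node (r : nat)
    (rec : forall t, nat -> digits -> state t -> seq (state t) -> bool)
    t Q (g1 g : digits) (st0 : state t) (sts : seq (state t)) : bool :=
  if r is 0 then ~~ all_lazy (survives M g1 g) (st0 :: sts)
  else
    let st := advance g st0 in
    if M <= last 0 (iter r (partial_sums 0) (map (@weight t) st.2))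
    then rec t Q g st (map (advance g) sts) else true.

(** [Q] is the index of the subgroup presented by [t] in a group of order [M].  The next
    generator is determined by its order [m] modulo that subgroup, a divisor of [Q], and by
    the value [c] of its [m]-th multiple; if [m] is 1 it is the element [c] itself.  The last
    generator has to generate the rest of the group. *)
Fixpoint refutes (r : nat) t Q (g1 : digits) (st0 : state t) (sts : seq (state t)) : bool :=
  if r is r'.+1 then
    all (fun m => all (fun c =>
           if m is 1 then node r' (@refutes r') Q g1 c st0 sts
           else node r' (@refutes r') (Q %/ m) (0 :: g1) (1 :: nseq (size t) 0)
                  (extend m c st0) (map (extend m c) sts))
         (all_digits t))
      (if r' is 0 then [:: Q] else [seq m <- iota 1 Q | m %| Q])
  else false.

End Search.

Definition no_coloring l d (ps : seq (seq nat)) M : bool :=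
  refutes M l.+1 (t := [::]) M [::] (start (d - l) (nseq d.-2 0)) (map (start (d - l)) ps).

(** * Correctness of the columns *)

Section Columns.

Variables (Z : finZmodType) (h : nat -> Z).
Local Open Scope ring_scope.

(** The semantics of the entry number [i] of column [k], where column 0 is that of [start]
    and column j + 1 that of h_j. *)
Definition entry (p : seq nat) (k i : nat) (x : Z) : bool :=
  if k is j.+1 then gap_reach h (rev (take (j + i) (rcons p 0%N))) j x
  else (i == 0%N) && (x == 0).

Lemma entryS p k i x : (k + i <= (size p).+1)%N ->
  let y := x - h k *+ nth 0%N (0%N :: rcons p 0%N) (k + i) in
  entry p k.+1 i x =
  entry p k i y || (if i is i'.+1 then entry p k.+1 i' y || entry p k.+1 i' (y - h k) else false).
Proof.
move=> le y; rewrite {1}/entry; case E: (k + i)%N => [|n].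
  have [-> ->] : k = 0%N /\ i = 0%N by lia.
  by rewrite take0 /y E /= mulr0n orbF subr0.
have szn : (n < size (rcons p 0%N))%N by rewrite size_rcons -E; lia.
rewrite (take_nth 0%N szn) rev_rcons gap_reach_cons.
have -> : x - h k *+ nth 0%N (rcons p 0%N) n = y by rewrite /y E.
case: i E le @y => [|i] E le y.
  have Ek : k = n.+1 by lia.
  subst k; rewrite !(@gap_reach_short _ _ _ n.+1) ?size_rev ?size_take_min ?ltnS ?geq_minl //.
  by rewrite orbF /entry addn0.
have En : n = (k + i)%N by lia.
rewrite {}En [LHS]orbA [LHS]orbC; congr (_ || _).
by rewrite /entry; case: k {E le} y szn => //= k y szn; rewrite addSnnS.
Qed.

Lemma gap_reach_span t bs gs j x : presents t bs ->
  (forall i, (i <= j)%N -> h i \in span t bs) -> gap_reach h gs j x -> x \in span t bs.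
Proof.
move=> pt; elim: gs j x => [|a gs IH] j x hs.
  by case/andP=> _ /eqP->; apply: span0.
have hj := hs j (leqnn j); rewrite gap_reach_cons.
rewrite -(spanBr x pt (spanMn a pt hj)); set y := (x - _).
case/or3P=> [/IH|/IH|]; first exact.
  by rewrite (spanBr y pt hj); apply.
by case: j hs @y {hj} => // j hs y /IH; apply=> i ij; apply/hs/leqW.
Qed.

Lemma entry_span t bs p k i : presents t bs ->
  (forall j, (j < k)%N -> h j \in span t bs) -> {subset entry p k i <= span t bs}.
Proof.
move=> pt hs x; rewrite unfold_in; case: k hs => [|k] hs /=.
  by case/andP=> _ /eqP->; apply: span0.
exact: gap_reach_span.
Qed.

Section Step.

Variables (t : tower) (bs : seq Z) (g : digits) (k : nat).
Hypotheses (pt : presents t bs) (gt : g \in all_digits t) (vg : value bs g = h k).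

Lemma next_entriesP prev gaps (col : seq (table t)) (E0 E1 : nat -> pred Z) :
  represents bs prev (E1 0%N) ->
  (forall i, (i < size col)%N -> represents bs (nth (empty t) col i) (E0 i.+1)) ->
  (forall i x, (i < size gaps)%N -> (i < size col)%N ->
     let y := x - h k *+ nth 0%N gaps i in
     E1 i.+1 x = E0 i.+1 y || (E1 i y || E1 i (y - h k))) ->
  let s := next_entries g prev gaps col in
  size s = minn (size gaps) (size col) /\
  forall i, (i < size s)%N -> represents bs (nth (empty t) s i) (E1 i.+1).
Proof.
elim: col prev gaps E0 E1 => [|s col IH] prev [|a gaps] E0 E1 rp rc EE //=.
set r := shift_by _ _ _.
have rr : represents bs r (E1 1%N).
  have := represents_shift_by a pt gt
    (represents_union3 (rc 0%N isT) rp (represents_shift pt gt rp)).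
  by apply: represents_ext => x; rewrite EE // vg.
have [sz H] := IH r gaps (fun i => E0 i.+1) (fun i => E1 i.+1) rr (fun i => rc i.+1)
  (fun i x => EE i.+1 x).
by rewrite sz minnSS; split=> // -[|i] // ilt; apply: H; rewrite sz.
Qed.

Definition column_of (p : seq nat) D k' (st : state t) : Prop :=
  [/\ st.1 = drop k' (0%N :: rcons p 0%N), size st.2 = D.+1
    & forall i, (i <= D)%N -> represents bs (nth (empty t) st.2 i) (entry p k' i)].

Lemma next_columnP p D st : column_of p D k st ->
  let s := next_column g st in
  size s = minn ((size p).+2 - k) D.+1 /\
  forall i, (i < size s)%N -> represents bs (nth (empty t) s i) (entry p k.+1 i).
Proof.
case: st => gaps [|s col] [] //= eg [sz] rc; rewrite /next_column /=.
have szg : size gaps = ((size p).+2 - k)%N by rewrite eg size_drop /= size_rcons.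
have ng i : nth 0%N gaps i = nth 0%N (0%N :: rcons p 0%N) (k + i) by rewrite eg nth_drop.
case: gaps szg ng {eg} => [|a gaps] szg ng /=; first by rewrite -szg.
set r := shift_by _ _ _.
have rr : represents bs r (entry p k.+1 0).
  apply: represents_ext (represents_shift_by a pt gt (rc 0%N isT)) => x.
  by rewrite entryS ?orbF ?vg -?(ng 0%N) //; move: szg => /=; lia.
have [] := @next_entriesP r gaps col (entry p k) (entry p k.+1) rr.
- by move=> i ilt; apply: (rc i.+1); rewrite -sz.
- by move=> i x ig ic; rewrite entryS -?(ng i.+1) //; move: szg => /=; lia.
move=> szs H; rewrite /= szs -szg /= sz minnSS; split=> // -[|i] //.
by rewrite ltnS -sz => ilt; apply: H; rewrite szs.
Qed.

Lemma advanceP p D st : (k + D <= (size p).+1)%N ->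
  column_of p D k st -> column_of p D k.+1 (advance g st).
Proof.
move=> le cst; have [sz H] := next_columnP cst; case: cst => eg _ _.
have szD : size (next_column g st) = D.+1 by rewrite sz; apply/minn_idPr; lia.
split=> //=; first by rewrite eg -drop1 drop_drop add1n.
by move=> i iD; apply: H; rewrite szD.
Qed.

Lemma robustP n g1 (A B : table t) (PA PB : pred Z) u : g1 \in all_digits t -> value bs g1 = u ->
  represents bs A PA -> represents bs B PB ->
  reflect (forall X, (X < n)%N -> {in span t bs, forall x,
             [|| PA (x - u *+ X), PB (x - h k *+ X) | PB (x - h k *+ X - h k)]})
          (robust n g1 g A B).
Proof.
move=> g1t vg1; elim: n A B PA PB => [|n IH] A B PA PB rA rB /=; first by constructor.
have rB' := represents_shift pt gt rB; have rA' := represents_shift pt g1t rA.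
case: (cover3P pt rA rB rB') => [c3|nc3]; last first.
  constructor=> H; apply: nc3 => x xt; have := H 0%N isT x xt.
  by rewrite /= !mulr0n !subr0 vg.
apply: (iffP (IH _ _ _ _ rA' rB')) => [H [|X] Xn x xt | H X Xn x xt].
- by have := c3 x xt; rewrite /= !mulr0n !subr0 vg.
- by have := H X Xn x xt; rewrite /= vg vg1 !mulrSr !opprD !addrA.
by have := H X.+1 Xn x xt; rewrite /= vg vg1 !mulrSr !opprD !addrA.
Qed.

End Step.

Lemma gap_reach_head a gs j x :
  gap_reach h (a :: gs) j x = gap_reach h (0%N :: gs) j (x - h j *+ a).
Proof. by rewrite !gap_reach_cons !subr0. Qed.

Lemma last_nth_size (T : Type) (x0 : T) s n : size s = n.+1 -> last x0 s = nth x0 s n.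
Proof. by move=> sz; rewrite -nth_last sz. Qed.

Lemma survivesP n t bs g1 g l D p (st : state t) : presents t bs ->
  g1 \in all_digits t -> value bs g1 = h l -> g \in all_digits t -> value bs g = h l.+1 ->
  column_of bs p D.+1 l.+1 st -> size p = (l + D)%N ->
  reflect (forall X, (X < n)%N -> {in span t bs, forall x, gap_reach h (0%N :: X :: rev p) l.+1 x})
          (survives n g1 g st).
Proof.
move=> pt g1t vg1 gt vg cst szp; rewrite /survives.
have [sz H] := next_columnP pt gt vg cst; case: cst => _ szc rc.
have szB : size (next_column g st) = D.+1 by rewrite sz szp; lia.
rewrite (last_nth_size _ szc) (last_nth_size _ szB).
have rA := rc _ (leqnn _); have rB := H D; rewrite szB ltnSn in rB.
have E X x : gap_reach h (0%N :: X :: rev p) l.+1 x =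
    [|| entry p l.+1 D.+1 (x - h l *+ X), entry p l.+2 D (x - h l.+1 *+ X)
      | entry p l.+2 D (x - h l.+1 *+ X - h l.+1)].
  rewrite gap_reach_cons !subr0 !(gap_reach_head X) /entry.
  rewrite !take_oversize ?size_rcons ?szp ?rev_rcons; [|lia..].
  by rewrite orbA orbC [x - _ - h _ *+ X]addrAC.
by apply: (iffP (robustP pt gt vg n g1t vg1 rA (rB isT))) => HH X Xn x xt;
  have := HH X Xn x xt; rewrite E.
Qed.

End Columns.

(** * Correctness of the search *)

Lemma size_partial_sums x ns : size (partial_sums x ns) = size ns.
Proof. by elim: ns x => //= n ns IH x; rewrite IH. Qed.

Lemma nth_partial_sums x ns i : i < size ns ->
  nth 0 (partial_sums x ns) i =
  (if i is i'.+1 then nth 0 (partial_sums x ns) i' else x) + nth 0 ns i.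
Proof.
elim: ns x i => //= n ns IH x [|i] // ilt.
by rewrite [LHS]/= IH //; case: i {ilt}.
Qed.

Fixpoint each (T : Type) (P : T -> Prop) (s : seq T) : Prop :=
  if s is x :: s' then P x /\ each P s' else True.

Lemma each_map (T U : Type) (f : T -> U) (P : T -> Prop) (Q : U -> Prop) s :
  (forall x, P x -> Q (f x)) -> each P s -> each Q (map f s).
Proof. by move=> PQ; elim: s => //= x s IH [/PQ Qx /IH]. Qed.

Lemma all_lazy_each (T : Type) (f : T -> bool) (P : T -> Prop) s :
  (forall x, P x -> f x) -> each P s -> all_lazy f s.
Proof. by move=> Pf; elim: s => //= x s IH [/Pf -> /IH]. Qed.

Section Refutation.

Variables (Z : finZmodType) (h : nat -> Z).
Local Open Scope ring_scope.

Lemma card_simplexS k t :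
  (#|simplex h k.+1 t| <= #|simplex h k t| + (if t is t'.+1 then #|simplex h k.+1 t'| else 0))%N.
Proof.
case: t => [|t].
  rewrite addn0; apply/subset_leq_card/subsetP => x.
  by rewrite -[x \in _]/(simplex h k.+1 0 x) simplexS orbF.
have -> : #|simplex h k.+1 t.+1| =
    #|[predU (simplex h k t.+1 : pred Z) & [pred x | simplex h k.+1 t (x - h k)]]|.
  by apply: eq_card => x; rewrite !inE -[LHS]/(simplex h k.+1 t.+1 x) simplexS.
apply: (@leq_trans (#|simplex h k t.+1| + #|[pred x | simplex h k.+1 t (x - h k)]|)).
  by rewrite -cardUI leq_addr.
rewrite leq_add2l.
have inj : injective (fun x : Z => x - h k) by apply: addIr.
rewrite -(card_image inj) subset_leq_card //; apply/subsetP => y /imageP[x].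
by rewrite !unfold_in => ? ->.
Qed.

Lemma iter_partial_sums D r k ns : size ns = D.+1 ->
  (forall i, (i <= D)%N -> (#|simplex h k i| <= nth 0 ns i)%N) ->
  (#|simplex h (k + r) D| <= last 0 (iter r (partial_sums 0) ns))%N.
Proof.
elim: r k ns => [|r IH] k ns sz le.
  by rewrite addn0 /= (last_nth_size _ sz) le.
rewrite iterSr addnS -addSn; apply: IH; first by rewrite size_partial_sums.
elim=> [|i IHi] iD; rewrite nth_partial_sums ?sz // (leq_trans (card_simplexS _ _)) //.
  by rewrite addn0 add0n le.
by rewrite addnC leq_add ?le // IHi // ltnW.
Qed.

Variables (l D : nat).
Hypothesis cov : forall gs x, size gs = (l.+1 + D.+1)%N -> gap_reach h gs l.+1 x.

Lemma cov_simplex : #|simplex h l.+2 D.+1| = #|Z|.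
Proof.
apply: eq_card => x; rewrite -[LHS]/(simplex h l.+2 D.+1 x) -gap_reach0 inE.
by apply: cov; rewrite size_nseq.
Qed.

(** The bound is the number of monomials of degree at most d - l in l + 1 variables. *)
Lemma card_le_binomial :
  (#|Z| <= last 0 (iter l.+2 (partial_sums 0) (nseq D.+2 1%N)))%N.
Proof.
rewrite -cov_simplex; apply: (@iter_partial_sums _ _ 0%N); first by rewrite size_nseq.
move=> i iD; rewrite nth_nseq ltnS iD -(card1 (0 : Z)).
by apply/subset_leq_card/subsetP => x; rewrite !unfold_in.
Qed.

(** The sums with all gaps 0 are the whole group, so the generators generate it. *)
Lemma span_all t bs : presents t bs -> (forall j, (j < l.+2)%N -> h j \in span t bs) ->
  size (all_digits t) = #|Z|.
Proof.
move=> pt hs; rewrite -(card_span pt); apply: eq_card => x.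
rewrite inE; apply: (gap_reach_span pt (j := l.+1) (gs := nseq (l.+1 + D.+1) 0%N)).
  by move=> i; apply: hs.
by apply: cov; rewrite size_nseq.
Qed.

Definition state_ok t bs k (st : state t) : Prop :=
  exists2 p, size p = (l + D)%N & column_of h bs p D.+1 k st.

Lemma extendP t bs p k m c u (st : state t) : presents ((m, c) :: t) (u :: bs) ->
  (forall j, (j < k)%N -> h j \in span t bs) ->
  column_of h bs p D.+1 k st -> column_of h (u :: bs) p D.+1 k (extend m c st).
Proof.
move=> pt2 hs [eg sz rc]; split=> //=; first by rewrite size_map.
move=> i iD; rewrite (nth_map (empty t)) ?sz //.
have pt : presents t bs by case: pt2.
exact: represents_lift pt2 (entry_span pt hs) (rc i iD).
Qed.

Lemma weight_bound t bs k (st : state t) : presents t bs ->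
  (forall j, (j < k.+1)%N -> h j \in span t bs) -> (k <= l)%N ->
  column_of h bs (nseq (l + D) 0%N) D.+1 k.+1 st ->
  forall i, (i <= D.+1)%N ->
  (#|simplex h k.+1 i| <= nth 0 (map (@weight t) st.2) i)%N.
Proof.
move=> pt hs kl [_ sz rc] i iD; rewrite (nth_map (empty t)) ?sz // (weightE (rc i iD) pt).
rewrite -size_filter; apply: leq_trans (card_size _).
apply/subset_leq_card/subsetP => x; rewrite unfold_in mem_filter => sx.
have ex : entry h (nseq (l + D) 0%N) k.+1 i x.
  rewrite /entry.
  have -> : rcons (nseq (l + D) 0%N) 0%N = nseq (l + D).+1 0%N.
    by rewrite -cats1 -[[:: 0%N]]/(nseq 1 0%N) -nseqD addn1.
  by rewrite take_nseq ?rev_nseq ?gap_reach0 //; lia.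
by rewrite ex; apply: (entry_span pt hs ex).
Qed.

(** In a group where all gap sequences reach everything, follow the branch of the search
    given by the actual orders of h_k, h_(k+1), ... modulo their predecessors: the bound
    holds at every node of it, and every gap sequence passes at its leaf. *)
Lemma refutesF r t bs Q g1 (st0 : state t) sts k : presents t bs ->
  (size (all_digits t) * Q = #|Z|)%N -> (k + r = l.+2)%N ->
  (forall j, (j < k)%N -> h j \in span t bs) ->
  ((0 < k)%N -> g1 \in all_digits t /\ value bs g1 = h k.-1) ->
  column_of h bs (nseq (l + D) 0%N) D.+1 k st0 -> each (state_ok bs k) sts ->
  ~~ refutes #|Z| r Q g1 st0 sts.
Proof.
elim: r t bs Q g1 st0 sts k => // r IH t bs Q g1 st0 sts k pt szQ kr hs hg1 c0 cs.
have nodeF t' bs' Q' g1' g (st0' : state t') sts' : presents t' bs' ->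
    (size (all_digits t') * Q' = #|Z|)%N ->
    (forall j, (j < k)%N -> h j \in span t' bs') ->
    ((0 < k)%N -> g1' \in all_digits t' /\ value bs' g1' = h k.-1) ->
    column_of h bs' (nseq (l + D) 0%N) D.+1 k st0' -> each (state_ok bs' k) sts' ->
    g \in all_digits t' -> value bs' g = h k ->
    ~~ node #|Z| r (@refutes #|Z| r) Q' g1' g st0' sts'.
  move=> pt' szQ' hs' hg1' c0' cs' gt vg.
  case: r IH kr => [|r] IH kr; rewrite /node.
    have ek : k = l.+1 by lia.
    subst k; have [g1t vg1] := hg1' isT; rewrite negbK.
    apply: (@all_lazy_each _ _ (state_ok bs' l.+1)); last first.
      by split=> //; exists (nseq (l + D) 0%N); rewrite ?size_nseq.
    move=> st [p szp cp]; apply/(survivesP _ pt' g1t vg1 gt vg cp szp) => X _ x _.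
    by apply: cov; rewrite /= size_rev szp; lia.
  have hs1 j : (j < k.+1)%N -> h j \in span t' bs'.
    rewrite ltnS leq_eqVlt => /orP[/eqP->|/hs' //].
    by rewrite -vg; apply/spanP; exists g.
  have c1 := advanceP pt' gt vg _ c0'; rewrite size_nseq in c1.
  have {}c1 := c1 ltac:(lia).
  rewrite ifT; last first.
    rewrite -cov_simplex (_ : l.+2 = k.+1 + r.+1)%N; last by lia.
    apply: iter_partial_sums; first by rewrite size_map; case: c1.
    by apply: (weight_bound pt' hs1 _ c1); lia.
  apply: (IH _ _ _ _ _ _ k.+1 pt' szQ' _ hs1 _ c1); [by lia | by [] |].
  apply: each_map cs' => st [p szp cp]; exists p => //.
  by apply: (advanceP pt' gt vg _ cp); lia.
have [m [c [ct um pt2]]] := tower_step (h k) pt.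
have m_gt0 : (0 < m)%N by case: pt2.
have t_gt0 : (0 < size (all_digits t))%N.
  by rewrite lt0n; apply/eqP => z; have := size0nil z; move: ct; case: (all_digits t).
have Q_gt0 : (0 < Q)%N.
  rewrite lt0n; apply: contraTneq isT => Q0; have : (0 < #|Z|)%N by apply/card_gt0P; exists 0.
  by rewrite -szQ Q0 muln0.
have sub x : x \in span t bs -> x \in span ((m, c) :: t) (h k :: bs).
  by move=> xt; apply/span_cons; exists 0%N, x; rewrite mulr0n add0r.
have hk2 : h k \in span ((m, c) :: t) (h k :: bs).
  case: (ltnP 1 m) => m1.
    apply/span_cons; exists 1%N, 0; split=> //; [exact: span0 | by rewrite mulr1n addr0].
  apply: sub; have em : m = 1%N by lia.
  by apply/spanP; exists c; rewrite // -um em.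
have mQ : (m %| Q)%N.
  have := all_digits_dvd pt2; rewrite size_all_digits_cons -szQ [X in (_ %| X)%N]mulnC.
  by rewrite dvdn_pmul2r.
have hs2 j : (j < k.+1)%N -> h j \in span ((m, c) :: t) (h k :: bs).
  by rewrite ltnS leq_eqVlt => /orP[/eqP->|/hs/sub].
have m_cand : m \in (if r is 0 then [:: Q] else [seq i <- iota 1 Q | i %| Q])%N.
  case: r kr {IH nodeF} => [|r] kr; last first.
    by rewrite mem_filter mQ mem_iota m_gt0 add1n ltnS dvdn_leq.
  rewrite inE -(eqn_pmul2l t_gt0) szQ mulnC -(size_all_digits_cons m c) (span_all pt2) //.
  by move=> j jl; apply: hs2; lia.
apply/negP => /= /allP/(_ m m_cand)/allP/(_ c ct); apply/negP.
have [m1|m1] := eqVneq m 1%N.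
  by rewrite m1 /=; apply: (nodeF _ bs) => //; rewrite -um m1.
have -> (b1 b2 : bool) : (if m is 1 then b1 else b2) = b2.
  by case: m m1 {um pt2 m_gt0 sub hk2 mQ hs2 m_cand} => [|[|m]].
have m2 : (1 < m)%N by lia.
apply: (nodeF _ (h k :: bs)) => //.
- by rewrite (size_all_digits_cons m c) -szQ -[in RHS](divnK mQ); lia.
- by move=> j jk; apply/sub/hs.
- move=> k0; have [g1t vg1] := hg1 k0; rewrite [_ \in _](mem_all_digits m c) m_gt0 g1t /=.
  by rewrite mulr0n add0r.
- exact: extendP pt2 hs c0.
- by apply: each_map cs => st [p szp cp]; exists p => //; apply: extendP pt2 hs cp.
- by rewrite [_ \in _](mem_all_digits m c) m2 (nseq0_digits pt).
- by rewrite /= value_nseq0 addr0.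
Qed.

End Refutation.

(** * Upper bounds and constructions *)

Definition max_colors l d : nat :=
  last 0 (iter l.+1 (partial_sums 0) (nseq (d - l).+1 1)).

(** With n = d + d M' there is room for all gap sequences with entries below M', and these
    are all of them modulo the order of the group. *)
Lemma upper_bound l d (ps : seq (seq nat)) M :
  0 < l < d -> all (fun p => size p == d.-2) ps ->
  all (no_coloring l d ps) (iota M.+1 (max_colors l d - M)) ->
  forall M', lin_colorable l d M' -> M' <= M.
Proof.
case: l => // l /andP[_ ld] sps none M' col; rewrite leqNgt; apply/negP => MM'.
have [D ed] : exists D, d = l.+1 + D.+1 by exists (d - l.+2); lia.
subst d; have [Z [f [cardZ [h fE] poly]]] := col _ (leq_addr ((l.+1 + D.+1) * M') (l.+1 + D.+1)).
pose hn j := h (inord j).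
have cov gs x : size gs = l.+1 + D.+1 -> gap_reach hn gs l.+1 x.
  move=> sz; rewrite -(@gap_reach_mod _ _ #|Z|); last exact: mulr_card.
  apply: (polychromatic_gap_reach fE x poly); rewrite ?size_map // addnC leq_add2l -sz.
  have M'_gt0 : 0 < #|Z| by rewrite cardZ (leq_trans _ MM').
  rewrite -cardZ; elim: (gs) => //= a s IH; rewrite mulSn leq_add // ltnW // ltn_pmod //.
have M'le : M' <= max_colors l.+1 (l.+1 + D.+1).
  by rewrite -cardZ /max_colors addKn; apply: card_le_binomial cov.
have M'in : M' \in iota M.+1 (max_colors l.+1 (l.+1 + D.+1) - M).
  by rewrite mem_iota MM' addSn subnKC // (leq_trans (ltnW MM')).
have startP p : column_of hn [::] p D.+1 0 (start D.+1 p).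
  split=> //=; first by rewrite size_nseq.
  move=> i iD; rewrite /entry eqxx andbT.
  by case: i iD => [|i] // iD; rewrite /= -[_ :: _]/(nseq D.+1 false) nth_nseq; case: ifP.
have /negP[] : ~~ no_coloring l.+1 (l.+1 + D.+1) ps M'; last exact: (allP none).
rewrite /no_coloring addKn -cardZ.
apply: (refutesF cov (bs := [::]) (k := 0)) => //=.
- by rewrite mul1n.
- by have := startP (nseq (l + D) 0); rewrite addnS.
elim: ps sps {none} => //= p ps IH /andP[/eqP szp /IH H]; split=> //.
by exists p; rewrite ?szp ?addnS.
Qed.

Fixpoint origin (t : tower) : table t :=
  if t is (m, c) :: t' then lift m c (origin t') else true.

(** Gap sequences are enumerated as the words of a tower all of whose levels have size [e],
    a multiple of the exponent of the group. *)
Definition always_survives l d t (gs : seq digits) e : bool :=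
  all (fun p => survives e (nth [::] gs l.-1) (nth [::] gs l)
        (foldl (fun st g => advance g st)
           (0 :: rcons p 0, origin t :: nseq (d - l) (empty t)) (take l gs)))
    (all_digits (nseq d.-2 (e, [::]))).

Section Construction.

Variables (Z : finZmodType) (h : nat -> Z) (t : tower) (bs : seq Z) (gs : seq digits).
Variables (l D e : nat).
Hypotheses (pt : presents t bs) (full : forall x, x \in span t bs).
Hypotheses (sz_gs : size gs = l.+2) (gsP : all (mem (all_digits t)) gs).
Hypothesis hE : forall j, j < l.+2 -> h j = value bs (nth [::] gs j).
Hypotheses (e_gt0 : 0 < e) (he : forall x : Z, (x *+ e = 0)%R).

Lemma represents_origin t' bs' : presents t' bs' -> represents bs' (origin t') (pred1 (0%R : Z)).
Proof.
elim: t' bs' => [|[m c] t' IH] [|b bs'] // pt'; first by rewrite /= eqxx.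
have pt1 : presents t' bs' by case: pt'.
apply: represents_lift pt' _ (IH _ pt1) => x; rewrite inE => /eqP->; exact: span0.
Qed.

Lemma always_survivesP : always_survives l.+1 (l.+1 + D.+1) t gs e ->
  forall ws x, size ws = l.+1 + D.+1 -> gap_reach h ws l.+1 x.
Proof.
move=> surv ws x; rewrite -(gap_reach_mod h ws l.+1 x he) -(size_map (fun a => a %% e) ws).
have : all (gtn e) [seq a %% e | a <- ws].
  by apply/allP => b /mapP[a _ ->] /=; rewrite ltn_pmod.
case: [seq a %% e | a <- ws] => [|a [|X rp]] //; first by move=> _ /=; lia.
case/and3P=> _ Xe rpe sz; rewrite /= in sz; rewrite gap_reach_head; set y := (_ - _)%R.
have szp : size (rev rp) = l + D by rewrite size_rev; lia.
have gt j : j < l.+2 -> nth [::] gs j \in all_digits t.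
  by move=> jl; apply: (allP gsP); rewrite mem_nth // sz_gs.
pose st k := foldl (fun st g => advance g st)
   (0 :: rcons (rev rp) 0, origin t :: nseq D.+1 (empty t)) (take k gs).
have cst k : k <= l.+1 -> column_of h bs (rev rp) D.+1 k (st k).
  elim: k => [_|k IH kl].
    rewrite /st take0; split=> //=; first by rewrite size_nseq.
    case=> [|i] iD; first exact: represents_origin.
    rewrite -[nth _ _ _]/(nth (empty t) (nseq D.+1 (empty t)) i) nth_nseq iD.
    by apply: represents_empty pt.
  rewrite /st (take_nth [::]) ?sz_gs; last by lia.
  rewrite foldl_rcons; apply: (advanceP pt _ _ _ (IH _)); [|by rewrite hE //; lia|lia|lia].
  by apply: gt; lia.
rewrite -[rp]revK.
have vg j : j < l.+2 -> value bs (nth [::] gs j) = h j by move/hE.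
have l2 : l < l.+2 by lia.
apply: (elimT (survivesP e pt (gt l l2) (vg l l2) (gt _ (ltnSn _)) (vg _ (ltnSn _))
  (cst _ (leqnn _)) szp) _ X Xe y (full y)).
have := allP surv (rev rp); rewrite addKn addnS /= /st; apply.
rewrite -szp; have : all (gtn e) (rev rp) by rewrite all_rev.
elim: (rev rp) => //= b s IH /andP[be /IH sm].
by rewrite [_ \in _](mem_all_digits e [::]) be.
Qed.

End Construction.

Section Product.

HB.instance Definition _ (U V : finZmodType) := GRing.Zmodule.on (U * V)%type.

Lemma pairMn (U V : zmodType) (x : U * V) n : (x *+ n = (x.1 *+ n, x.2 *+ n))%R.
Proof. by elim: n => [|n IH]; rewrite ?mulr0n // !mulrS IH; case: x {IH}. Qed.

Lemma mulrn_Zp m n : 1 < m -> (1 *+ n == 0 :> 'Z_m)%R = (m %| n).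
Proof. by move=> m1; rewrite -val_eqE /= val_Zp_nat. Qed.

Lemma Zp_mulrn m n (x : 'Z_m) : 1 < m -> m %| n -> (x *+ n = 0)%R.
Proof.
move=> m1 mn; rewrite -mulr_natr -[(n%:R)%R]/((1 *+ n)%R).
by have := mulrn_Zp n m1; rewrite mn => /eqP->; rewrite mulr0.
Qed.

Variables (a b : nat).
Hypotheses (a1 : 1 < a) (b1 : 1 < b).

Definition product_tower : tower := [:: (a, [:: 0]); (b, [::])].

Let basis : seq ('Z_a * 'Z_b) := [:: (1%R, 0%R); (0%R, 1%R)].

Lemma presents_product : presents product_tower basis.
Proof.
split; [|by lia|by rewrite [_ \in _](mem_all_digits b [::]) inE eqxx andbT; lia| |].
- split=> //; first by lia.
    by rewrite pairMn /= mul0rn Zp_mulrn.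
  move=> q /andP[q0 qb]; rewrite inE pairMn /= mul0rn xpair_eqE eqxx mulrn_Zp //.
  by rewrite gtnNdvd.
- by rewrite pairMn /= mul0rn Zp_mulrn // pairMn /= !mulr0n addr0.
move=> q /andP[q0 qa]; apply/negP => /mapP[[|p [|? ?]] _] /=.
all: rewrite !pairMn ?addr0 /= => -[/eqP]; rewrite ?mul0rn mulrn_Zp // gtnNdvd //.
Qed.

Lemma product_coloring l d (gs : seq digits) e : 0 < l < d -> size gs = l.+1 ->
  all (mem (all_digits product_tower)) gs -> 0 < e -> a %| e -> b %| e ->
  always_survives l d product_tower gs e -> lin_colorable l d (a * b).
Proof.
case: l => // l /andP[_ ld] szgs gsP e0 ae be surv n dn.
have [D ed] : exists D, d = l.+1 + D.+1 by exists (d - l.+2); lia.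
subst d; pose h (i : 'I_l.+2) := value basis (nth [::] gs i).
have card_ab : #|{: 'Z_a * 'Z_b}| = a * b by rewrite card_prod !card_ord !Zp_cast.
exists ('Z_a * 'Z_b)%type, (fun c => \sum_(i < l.+2) h i *+ counting_vector c i)%R.
split=> //; first by exists h.
apply: (gap_reach_polychromatic (h := h)) => // ws x szw.
have full y : y \in span product_tower basis.
  have /subset_cardP : #|span product_tower basis| = #|{: 'Z_a * 'Z_b}|.
    rewrite (card_span presents_product) card_ab !size_all_digits_cons /=; lia.
  by move=> /(_ (subset_predT _))/(_ y); rewrite inE.
apply: (always_survivesP presents_product full szgs gsP _ e0 _ surv) => //.
  by move=> j jl; rewrite /h inordK.
by move=> y; rewrite pairMn !Zp_mulrn.
Qed.

End Product.

(** * The six values *)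

(** Each entry of the lists below gives the gaps after the first d - 2 stars, from left to
    right.  The lists were found by a greedy computer search: for every presentation that
    survives the bound and the sequence with all gaps 0, one of the entries leaves out a
    colour for some value of the next gap. *)

Definition gaps_2_4 : seq (seq nat) :=
  [:: [:: 1; 0]].

Definition gaps_2_5 : seq (seq nat) :=
  [:: [:: 0; 4; 0]; [:: 3; 0; 0]; [:: 0; 0; 3]; [:: 0; 6; 4]; [:: 2; 0; 9]; [:: 0; 0; 6];
      [:: 0; 3; 0]; [:: 1; 0; 0]; [:: 0; 5; 9]; [:: 1; 0; 1]; [:: 4; 0; 5]; [:: 0; 1; 0]].

Definition gaps_3_5 : seq (seq nat) :=
  [:: [:: 5; 0; 0]; [:: 3; 0; 0]; [:: 0; 1; 0]; [:: 2; 0; 0]; [:: 6; 0; 2]; [:: 0; 0; 1];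
      [:: 0; 1; 6]; [:: 5; 2; 0]; [:: 6; 0; 5]; [:: 4; 0; 5]; [:: 0; 4; 3]; [:: 5; 0; 4];
      [:: 0; 3; 0]; [:: 0; 2; 1]; [:: 0; 5; 0]; [:: 0; 1; 5]].

Definition gaps_2_6 : seq (seq nat) :=
  [:: [:: 0; 0; 0; 2]; [:: 0; 5; 0; 0]; [:: 0; 16; 0; 0]; [:: 0; 15; 0; 0]; [:: 0; 4; 0; 0];
      [:: 14; 0; 0; 0]; [:: 0; 0; 0; 14]; [:: 0; 0; 2; 0]; [:: 7; 0; 0; 11]; [:: 15; 0; 0; 12];
      [:: 12; 3; 9; 0]; [:: 3; 0; 0; 16]; [:: 11; 0; 0; 4]; [:: 12; 6; 0; 0]; [:: 0; 0; 0; 1];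
      [:: 0; 9; 0; 0]].

Definition gaps_3_6 : seq (seq nat) :=
  [:: [:: 13; 0; 0; 0]; [:: 0; 2; 0; 0]; [:: 0; 0; 5; 0]; [:: 11; 0; 0; 0]; [:: 0; 8; 0; 0];
      [:: 0; 0; 9; 0]; [:: 0; 0; 0; 11]; [:: 0; 11; 0; 0]; [:: 5; 0; 4; 0]; [:: 0; 0; 12; 0];
      [:: 12; 0; 0; 0]; [:: 0; 9; 0; 0]; [:: 0; 0; 6; 0]; [:: 0; 10; 0; 0]; [:: 7; 0; 0; 13];
      [:: 0; 0; 8; 0]; [:: 1; 13; 0; 0]; [:: 13; 0; 0; 9]; [:: 2; 0; 0; 0]; [:: 0; 0; 3; 0];
      [:: 3; 11; 0; 0]; [:: 6; 12; 0; 0]; [:: 0; 0; 0; 12]; [:: 0; 13; 11; 13];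
      [:: 3; 0; 0; 13]; [:: 0; 12; 0; 0]; [:: 13; 7; 0; 0]; [:: 10; 0; 0; 2]; [:: 0; 8; 0; 12];
      [:: 9; 0; 0; 13]; [:: 4; 0; 0; 0]; [:: 12; 0; 6; 12]; [:: 6; 12; 2; 0]; [:: 0; 3; 0; 13];
      [:: 0; 13; 0; 11]; [:: 12; 0; 0; 8]; [:: 12; 0; 11; 12]; [:: 5; 6; 0; 0];
      [:: 8; 0; 0; 12]; [:: 12; 0; 2; 0]; [:: 12; 8; 0; 0]; [:: 11; 0; 0; 3];
      [:: 7; 0; 12; 13]; [:: 13; 10; 0; 12]; [:: 2; 3; 12; 0]; [:: 0; 0; 10; 0];
      [:: 12; 0; 0; 3]; [:: 4; 0; 11; 0]; [:: 13; 1; 0; 0]; [:: 2; 0; 13; 7]; [:: 0; 0; 9; 4];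
      [:: 11; 13; 0; 12]; [:: 12; 13; 10; 0]; [:: 8; 0; 4; 0]; [:: 12; 0; 0; 4];
      [:: 12; 0; 0; 1]; [:: 0; 0; 12; 5]; [:: 0; 8; 0; 6]; [:: 2; 13; 0; 12]; [:: 6; 0; 0; 4];
      [:: 0; 0; 2; 0]; [:: 0; 0; 0; 6]; [:: 0; 12; 0; 1]; [:: 12; 1; 0; 6]].

Definition gaps_4_6 : seq (seq nat) :=
  [:: [:: 0; 9; 0; 0]; [:: 1; 0; 0; 0]; [:: 2; 0; 4; 0]; [:: 0; 6; 0; 9]; [:: 0; 3; 0; 0];
      [:: 0; 8; 9; 0]; [:: 0; 0; 2; 0]; [:: 4; 0; 0; 1]; [:: 0; 0; 9; 9]; [:: 3; 0; 1; 9];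
      [:: 0; 0; 0; 3]; [:: 1; 0; 0; 4]; [:: 1; 0; 0; 3]; [:: 0; 0; 0; 2]].

Lemma no_coloring_2_4 :
  all (no_coloring 2 4 gaps_2_4) (iota 7 (max_colors 2 4 - 6)).
Proof. by vm_cast_no_check (erefl true). Qed.

Lemma no_coloring_2_5 :
  all (no_coloring 2 5 gaps_2_5) (iota 10 (max_colors 2 5 - 9)).
Proof. by vm_cast_no_check (erefl true). Qed.

Lemma no_coloring_3_5 :
  all (no_coloring 3 5 gaps_3_5) (iota 7 (max_colors 3 5 - 6)).
Proof. by vm_cast_no_check (erefl true). Qed.

Lemma no_coloring_2_6 :
  all (no_coloring 2 6 gaps_2_6) (iota 17 (max_colors 2 6 - 16)).
Proof. by vm_cast_no_check (erefl true). Qed.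

Lemma no_coloring_3_6 :
  all (no_coloring 3 6 gaps_3_6) (iota 13 (max_colors 3 6 - 12)).
Proof. by vm_cast_no_check (erefl true). Qed.

Lemma no_coloring_4_6 :
  all (no_coloring 4 6 gaps_4_6) (iota 10 (max_colors 4 6 - 9)).
Proof. by vm_cast_no_check (erefl true). Qed.

Theorem proposition8 :
  is_plin 2 4 6 /\ is_plin 2 5 9 /\ is_plin 3 5 6 /\
  is_plin 2 6 16 /\ is_plin 3 6 12 /\ is_plin 4 6 9.
Proof.
split; [|split; [|split; [|split; [|split]]]]; split.
(* The words are the h_i.  In Z/6, written as Z/3 x Z/2, these are 1, -1, 2 and, for l = 3,
   0, 1, -1, 2; for l = 2 and d = 6 they are three elements of Z/4 x Z/4 with sum 0. *)
- apply: (@product_coloring 3 2 _ _ 2 4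
    [:: [:: 1; 1]; [:: 2; 1]; [:: 2; 0]] 6); by vm_compute.
- exact: (@upper_bound 2 4 gaps_2_4 _ isT isT no_coloring_2_4).
- apply: (@product_coloring 3 3 _ _ 2 5
    [:: [:: 0; 1]; [:: 1; 0]; [:: 1; 1]] 3); by vm_compute.
- exact: (@upper_bound 2 5 gaps_2_5 _ isT isT no_coloring_2_5).
- apply: (@product_coloring 3 2 _ _ 3 5
    [:: [:: 0; 0]; [:: 1; 1]; [:: 2; 1]; [:: 2; 0]] 6); by vm_compute.
- exact: (@upper_bound 3 5 gaps_3_5 _ isT isT no_coloring_3_5).
- apply: (@product_coloring 4 4 _ _ 2 6
    [:: [:: 0; 1]; [:: 1; 0]; [:: 3; 3]] 4); by vm_compute.
- exact: (@upper_bound 2 6 gaps_2_6 _ isT isT no_coloring_2_6).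
- apply: (@product_coloring 6 2 _ _ 3 6
    [:: [:: 0; 1]; [:: 1; 0]; [:: 2; 1]; [:: 3; 1]] 6); by vm_compute.
- exact: (@upper_bound 3 6 gaps_3_6 _ isT isT no_coloring_3_6).
- apply: (@product_coloring 3 3 _ _ 4 6
    [:: [:: 0; 1]; [:: 1; 0]; [:: 0; 2]; [:: 1; 1]; [:: 1; 0]] 3); by vm_compute.
- exact: (@upper_bound 4 6 gaps_4_6 _ isT isT no_coloring_4_6).
Qed.
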